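(* There is an absolute constant $C > 0$ such that the following holds for every integer $n \ge 1$ and every real $\delta \ge 0$. Let $D = (V,E)$ be a loopless $\vec{C}_3$-free digraph on $n$ vertices. If $$\sum_{v \in V} d^+(v)^2 \ge \frac{n^3}{3} - \delta n^3,$$ then the edit distance from $D$ to the ordered digon-chain $\vec{F}_{n,2}$ is at most $C\,\delta^{1/2} n^2$.
   Context: Digraphs are finite, loopless, and have no multiple arcs in the same direction; 2-cycles (digons, i.e. arcs in both directions between a pair of vertices) are permitted. $d^+(v)$ denotes the out-degree of $v$. $\vec{C}_3$ is the directed cycle of length 3, and a digraph is $\vec{C}_3$-free if it contains no (not necessarily induced) subdigraph isomorphic to $\vec{C}_3$. The ordered digon-chain $\vec{F}_{n,2}$ on $n = 2q + r$ vertices ($0 \le r < 2$) is defined by partitioning the vertices into an ordered sequence of $q$ blocks of size 2, each of which is a complete digraph (a digon), followed by one final block of size $r$ (with no arcs inside it; empty if $r=0$), with all arcs between different blocks present exactly in the direction from the earlier block to the later block. The edit distance between two digraphs on $n$ vertices is the minimum number of arc additions and deletions required to make them isomorphic. *)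

(* Defs.v *)
From mathcomp Require Import all_boot all_order all_algebra.
From mathcomp Require Import boolp reals.

Set Implicit Arguments.
Unset Strict Implicit.
Unset Printing Implicit Defensive.

(* A digraph is given by its arc relation [e : rel V] on a finite vertex type;
   it is loopless when [irreflexive e].  Digons are pairs x, y with both
   [e x y] and [e y x]. *)

Definition outdeg (V : finType) (e : rel V) (v : V) : nat :=
  #|[set w | e v w]|.

Definition digraph_iso (V W : finType) (e : rel V) (f : rel W) : Prop :=
  exists2 h : V -> W, bijective h & forall x y, e x y = f (h x) (h y).

(* Not necessarily induced: non-arcs of [f] may be mapped to arcs of [e]. *)
Definition has_subdigraph (V W : finType) (e : rel V) (f : rel W) : Prop :=
  exists2 h : W -> V, injective h & forall x y, f x y -> e (h x) (h y).

Definition dicycle (n : nat) : rel 'I_n := fun i j => j == ordS i.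

Definition C3_free (V : finType) (e : rel V) : Prop :=
  ~ has_subdigraph e (@dicycle 3).

(* The block of vertex i is i./2; when n is odd, the last vertex n.-1 forms a
   block by itself. *)
Definition digon_chain (n : nat) : rel 'I_n :=
  fun i j => (i./2 < j./2) || ((i./2 == j./2) && (i != j)).

(* Adds the pairs of S that are not arcs of e and deletes those that are. *)
Definition edit (V : finType) (e : rel V) (S : {set V * V}) : rel V :=
  fun x y => e x y (+) ((x, y) \in S).

(* The default value #|V * V| bounds every #|S|, so this is the true minimum
   whenever some edit is admissible, i.e. whenever #|V| = #|W|.  If e and f are
   loopless, then an admissible S contains no pair (x, x). *)
Definition edit_dist (V W : finType) (e : rel V) (f : rel W) : nat :=
  \big[Order.min/#|{: V * V}|]_(S : {set V * V} | `[< digraph_iso (edit e S) f >])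
     #|S|.

(* Main.v *)
Require Import Defs.
From mathcomp Require Import all_boot all_order all_algebra.
From mathcomp Require Import boolp reals.
From mathcomp Require Import zify ring lra.
Import Order.TTheory GRing.Theory Num.Theory.
Local Open Scope ring_scope.
Set Implicit Arguments.
Unset Strict Implicit.
Unset Printing Implicit Defensive.

(** A set S of k vertices spans at most k^2/2 arcs when there is no directed
    triangle ([arcs_le]), and it sends at most k(n-k) arcs to its complement.
    So, with the vertices listed by decreasing out-degree as d_0, ..., d_(n-1),
    the sum of the first k out-degrees is at most kn - k^2/2, which is the sum
    of the first k of the numbers a_i = n - i - 1/2.  The sequence a dominates
    d, and the sum of the a_i^2 is n^3/3 - n/12; by convexity the sum of the
    d_i^2 is at most that, and the hypothesis says that it is almost attained.

    Abel summation, in the form of a sum over the upper level sets of d, keeps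
    track of the loss ([outdeg_energy], [outdeg_deviation]).  Put s = sqrt(delta) n,
    t_i = d_i - a_i, and let Q be the sum of max(d_x - d_y, 0) over the non-arcs
    (x, y).  Then

       sum_i t_i^2 + 2 Q + n/12 <= s^2 n.

    The third term gives s >= 1/4, so that an error of n edits is O(s n), and the
    first gives sum_i |t_i| <= s n by Cauchy-Schwarz.  Together with the second
    they bound the number M of pairs i < j with no arc from i to j
    ([missing_ahead_le]): such a pair either has d_i - d_j >= s, and contributes
    at least s to Q, or it has j - i < s + |t_i| + |t_j|, which is true of only
    O(s n + sum_i |t_i|) pairs.  Hence M = O(s n).
    The arcs number at most n^2/2 in all, so at most M + n/2 of them go from a
    later vertex to an earlier one ([arcs_back_le]).

    Placing the vertices in this order, the digon-chain is the transitive
    tournament plus at most n backward arcs, whence an edit distance of at most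
    M + (M + n/2) + n = O(s n) = O(sqrt(delta) n^2). *)

(** * Sums over ordinals *)

Lemma sum_ord_between n a b : (b <= n)%N -> (\sum_(t < n) (a <= t < b) = b - a)%N.
Proof.
elim: n b => [|n IHn] b; first by rewrite big_ord0; lia.
rewrite big_ord_recr leq_eqVlt ltnS => /orP[/eqP->|bn] /=; last first.
  by rewrite IHn //; lia.
rewrite (eq_bigr (fun t : 'I_n => (a <= t < n) : nat)) ?IHn //.
  by lia.
by move=> t _; have := ltn_ord t; lia.
Qed.

Lemma sum_ltn_pairs n (S : {set 'I_n}) :
  ((\sum_(i in S) \sum_(j in S) (i < j)).*2 + #|S| = #|S| ^ 2)%N.
Proof.
rewrite -addnn [X in (_ + X + _)%N]exchange_big /= -[X in (_ + X)%N]sum1_card -mulnn.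
rewrite -[RHS]sum_nat_const -!big_split /=; apply: eq_bigr => i iS.
rewrite -sum1_card -big_split /= !(big_setD1 i iS) /= !ltnn !add0n addnC; congr addn.
apply: eq_bigr => j; rewrite !inE => /andP[/negP ji _].
by case: ltngtP => // /val_inj ij; case: ji; rewrite ij.
Qed.

Lemma sum_odd_squares m : ((\sum_(i < m) ((m - i).*2.-1) ^ 2) * 3 + m = 4 * m ^ 3)%N.
Proof.
elim: m => [|m IHm]; first by rewrite big_ord0.
rewrite big_ord_recl subn0.
under eq_bigr do rewrite lift0 subSS.
have -> : m.+1.*2.-1 = (2 * m + 1)%N by lia.
move: IHm; set X := (\sum_(i < m) _)%N; move: X => X; rewrite !expnS !expn0; nia.
Qed.

Lemma sum_split_set (T : finType) (S : {set T}) (F : T -> nat) :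
  (\sum_j F j = \sum_(j in S) F j + \sum_(j in ~: S) F j)%N.
Proof.
by rewrite (bigID (mem S)) /=; congr addn; apply: eq_bigl => j; rewrite inE.
Qed.

Lemma sum_const_ord (R : pzRingType) n (x : R) : \sum_(i < n) x = x * n%:R.
Proof. by rewrite sumr_const card_ord mulr_natr. Qed.

Lemma near_le (R : realType) n (p : pred 'I_n) (k : nat) (x : R) : 0 <= x ->
    (forall j, p j -> k <= j < k + Num.truncn x)%N ->
  (\sum_(j < n) p j)%N%:R <= x.
Proof.
move=> x0 pk; have trunc_x : (Num.truncn x)%:R <= x by rewrite truncn_le.
apply: le_trans trunc_x; rewrite ler_nat.
have le_k : (\sum_(j < n) (k <= j < minn n (k + Num.truncn x)) <= Num.truncn x)%N.
  by rewrite sum_ord_between ?geq_minl //; lia.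
apply: leq_trans le_k; apply: leq_sum => j _.
by case pj: (p j) => //; rewrite leq_min ltn_ord pk.
Qed.

Lemma after_le (R : realType) n (i : 'I_n) (x : R) : 0 <= x ->
  (\sum_(j < n) ((i < j) && (j%:R - i%:R < x)%R))%N%:R <= x.
Proof.
move=> x0; apply: (@near_le _ _ _ i.+1) => // j /andP[ij].
rewrite -natrB ?(ltnW ij) // => /ltW; rewrite -truncn_ge_nat //; lia.
Qed.

Lemma before_le (R : realType) n (j : 'I_n) (x : R) : 0 <= x ->
  (\sum_(i < n) ((i < j) && (j%:R - i%:R < x)%R))%N%:R <= x.
Proof.
move=> x0; apply: (@near_le _ _ _ (j - Num.truncn x)) => // i /andP[ij].
rewrite -natrB ?(ltnW ij) // => /ltW; rewrite -truncn_ge_nat //; lia.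
Qed.

(** * Digraphs without directed triangles *)

Lemma outdegE (V : finType) (e : rel V) v : outdeg e v = (\sum_w e v w)%N.
Proof.
rewrite /outdeg -sum1_card big_mkcond.
by apply: eq_bigr => w _; rewrite inE; case: e.
Qed.

Lemma C3_freeW (V : finType) (e : rel V) : irreflexive e -> C3_free e ->
  forall x y z, e x y -> e y z -> ~~ e z x.
Proof.
move=> irr C3 x y z exy eyz; apply/negP => ezx; apply: C3.
have neq u v : e u v -> u != v by move=> euv; apply: contraTneq euv => ->; rewrite irr.
exists (fun i : 'I_3 => nth x [:: x; y; z] i).
  have u3 : uniq [:: x; y; z].
    by rewrite /= !inE negb_or neq // (neq y z) // eq_sym neq.
  by move=> i j /eqP; rewrite nth_uniq // => /eqP/val_inj.
move=> i j /eqP ->.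
by case: i => [[|[|[|//]]] ?].
Qed.

(** Induction: deleting a digon from S removes its 2 arcs and at most
    2 (#|S| - 2) arcs to the rest, exactly the decrease of #|S|^2/2; without a
    digon, S spans at most one arc per pair. *)
Lemma arcs_le (V : finType) (e : rel V) (S : {set V}) : irreflexive e ->
    (forall x y z, e x y -> e y z -> ~~ e z x) ->
  ((\sum_(x in S) \sum_(y in S) e x y).*2 <= #|S| ^ 2)%N.
Proof.
move=> irr C3; have [m] := ubnP #|S|; elim: m S => // m IHm S leSm.
have [[x y] /= /and4P[xS yS exy eyx]|noD] :=
  pickP (fun p : V * V => [&& p.1 \in S, p.2 \in S, e p.1 p.2 & e p.2 p.1]).
  have nyx : y != x by apply: contraTneq exy => ->; rewrite irr.
  have yS' : y \in S :\ x by rewrite !inE nyx.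
  pose S' := S :\ x :\ y.
  have cardS : #|S| = #|S'|.+2 by rewrite (cardsD1 x) xS (cardsD1 y (S :\ x)) yS'.
  have split (F : V -> nat) : (\sum_(z in S) F z = F x + (F y + \sum_(z in S') F z))%N.
    rewrite (big_setD1 x) //= (big_setD1 y) //=.
  have IH := IHm S' ltac:(lia).
  rewrite split (eq_bigr _ (fun z _ => split (fun w => nat_of_bool (e z w)))).
  rewrite !split !irr exy eyx !big_split /=.
  (* If x and y form a digon, at most two arcs join z to {x, y}. *)
  have cross : (\sum_(z in S') (e x z + e y z + e z x + e z y) <= \sum_(z in S') 2)%N.
    apply: leq_sum => z _.
    have := C3 x y z exy; have := C3 y x z eyx.
    by case: (e x z) (e y z) (e z x) (e z y) => [] [] [] [] // H1 H2;
      do [have := H1 isT | have := H2 isT].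
  rewrite !big_split sum_nat_const /= in cross.
  rewrite cardS; lia.
(* Without digons, each pair of vertices spans at most one arc. *)
have : (\sum_(x in S) \sum_(y in S) (e x y + e y x) <= \sum_(x in S) \sum_(y in S) 1)%N.
  apply: leq_sum => x xS; apply: leq_sum => y yS.
  by move: (noD (x, y)); rewrite /= xS yS /=; case: (e x y) (e y x) => [] [].
under eq_bigr do rewrite big_split /=.
rewrite big_split /= [X in (_ + X)%N]exchange_big /= addnn.
by under [X in (_ <= X)%N]eq_bigr do rewrite sum1_card; rewrite sum_nat_const -mulnn.
Qed.

(** * Out-degree sums under a decreasing labelling *)

Definition missing_ahead n (e : rel 'I_n) : nat :=
  \sum_(i < n) \sum_(j < n) ((i < j) && ~~ e i j).

Definition arcs_back n (e : rel 'I_n) : nat :=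
  \sum_(i < n) \sum_(j < n) ((j < i) && e i j).

Section DecreasingLabelling.
Variables (n : nat) (e : rel 'I_n).
Hypothesis irr : irreflexive e.
Hypothesis no_triangle : forall x y z, e x y -> e y z -> ~~ e z x.
Let d (i : 'I_n) := outdeg e i.
Hypothesis d_anti : forall i j : 'I_n, (i <= j)%N -> (d j <= d i)%N.

(** The domination of d by a on an initial segment, doubled to stay in nat: the
    term (n - i).*2.-1 is 2 a_i = 2 (n - i - 1/2).  The loss includes the number
    of non-arcs leaving the segment. *)
Lemma initial_outdeg_le (S : {set 'I_n}) :
    (forall i j, i \in S -> j \notin S -> (i < j)%N) ->
  ((\sum_(i in S) d i).*2 + (\sum_(i in S) \sum_(j in ~: S) ~~ e i j).*2
    <= \sum_(i in S) (n - i).*2.-1)%N.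
Proof.
move=> initS.
have later (i : 'I_n) : ((n - i).*2.-1 = (\sum_(j < n) (i < j)).*2 + 1)%N.
  have -> : (\sum_(j < n) (i < j) = n - i.+1)%N.
    by rewrite -(@sum_ord_between n) //; apply: eq_bigr => j _; rewrite ltn_ord andbT.
  have := ltn_ord i; lia.
have out : (\sum_(i in S) d i + \sum_(i in S) \sum_(j in ~: S) ~~ e i j
            = \sum_(i in S) \sum_(j in S) e i j + #|S| * #|~: S|)%N.
  rewrite -sum_nat_const -!big_split; apply: eq_bigr => i _ /=.
  rewrite /d outdegE (sum_split_set S) -addnA -big_split; congr addn.
  by rewrite -sum1_card; apply: eq_bigr => j _; case: e.
have lat : (\sum_(i in S) (n - i).*2.-1
   = (\sum_(i in S) \sum_(j in S) (i < j)).*2 + (#|S| * #|~: S|).*2 + #|S|)%N.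
  rewrite -doubleD -(sum_nat_const (mem S)) -big_split -muln2 big_distrl /=.
  rewrite -[X in (_ + X)%N]sum1_card -big_split /=.
  apply: eq_bigr => i iS; rewrite later (sum_split_set S) muln2; congr ((_ + _).*2 + _)%N.
  by rewrite -sum1_card; apply: eq_bigr => j; rewrite inE => /(initS i j iS) ->.
have sq := sum_ltn_pairs S.
have := arcs_le S irr no_triangle; lia.
Qed.

(** The sum over all thresholds t of [initial_outdeg_le] applied to the level set
    {d > t}: a vertex i is counted d i times, and a non-arc (i, j) leaves the
    level set for exactly d i - d j thresholds (truncated subtraction). *)
Lemma outdeg_energy :
  ((\sum_i d i ^ 2).*2 + (\sum_i \sum_j ~~ e i j * (d i - d j)).*2
    <= \sum_(i < n) d i * (n - i).*2.-1)%N.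
Proof.
have dn i : (d i <= n)%N by rewrite -[leqRHS]card_ord; apply: max_card.
(* Each sum is spread over the level sets {d > t}, which are initial segments. *)
have layer (F : 'I_n -> nat) :
    (\sum_i d i * F i = \sum_(t < n) \sum_(i in [set i | t < d i]) F i)%N.
  rewrite [RHS](eq_bigr (fun t : 'I_n => \sum_i (0 <= t < d i) * F i))%N; last first.
    move=> t _; rewrite big_mkcond; apply: eq_bigr => i _ /=.
    by rewrite inE; case: ltnP; rewrite ?mul1n.
  rewrite exchange_big; apply: eq_bigr => i _ /=.
  by rewrite -big_distrl (sum_ord_between 0) // subn0.
have layerM : (\sum_i \sum_j ~~ e i j * (d i - d j) =
    \sum_(t < n) \sum_(i in [set i | t < d i]) \sum_(j in ~: [set i | t < d i]) ~~ e i j)%N.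
  rewrite [RHS](eq_bigr
    (fun t : 'I_n => \sum_i \sum_j ~~ e i j * (d j <= t < d i)))%N; last first.
    move=> t _; rewrite big_mkcond; apply: eq_bigr => i _ /=; rewrite inE.
    rewrite big_mkcond /=; case: ltnP => _; last first.
      by rewrite big1 // => j _; rewrite andbF muln0.
    by apply: eq_bigr => j _; rewrite !inE -leqNgt andbT; case: leqP; rewrite ?muln1 ?muln0.
  rewrite [RHS]exchange_big; apply: eq_bigr => i _ /=.
  rewrite exchange_big; apply: eq_bigr => j _ /=.
  by rewrite -big_distrr sum_ord_between.
rewrite (eq_bigr (fun i => d i * d i)%N) // !layer layerM.
rewrite -!muln2 !big_distrl -big_split; apply: leq_sum => t _ /=.
rewrite !muln2; apply: initial_outdeg_le => i j; rewrite !inE => ti tj.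
by rewrite ltnNge; apply: contra tj => /d_anti; apply: leq_trans.
Qed.

(** The n(n-1)/2 pairs i < j carry an arc from i to j except for the missing
    ones, and there are at most n^2/2 arcs in total. *)
Lemma arcs_back_le : ((arcs_back e).*2 <= (missing_ahead e).*2 + n)%N.
Proof.
rewrite /arcs_back /missing_ahead.
have := arcs_le setT irr no_triangle; rewrite -sum_ltn_pairs cardsT card_ord.
under eq_bigl do rewrite inE; under eq_bigr do under eq_bigl do rewrite inE.
under [X in (_ <= X.*2 + _)%N -> _]eq_bigl do rewrite inE.
under [X in (_ <= X.*2 + _)%N -> _]eq_bigr do under eq_bigl do rewrite inE.
have -> : (\sum_i \sum_j e i j = \sum_(i < n) \sum_(j < n) ((i < j) && e i j) +
   \sum_(i < n) \sum_(j < n) ((j < i) && e i j))%N.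
  rewrite -big_split; apply: eq_bigr => i _; rewrite -big_split; apply: eq_bigr => j _ /=.
  by case: ltngtP => // [|/val_inj ->]; rewrite ?addn0 ?irr.
have -> : (\sum_(i < n) \sum_(j < n) (i < j) =
   \sum_(i < n) \sum_(j < n) ((i < j) && e i j) +
   \sum_(i < n) \sum_(j < n) ((i < j) && ~~ e i j))%N.
  rewrite -big_split; apply: eq_bigr => i _; rewrite -big_split; apply: eq_bigr => j _ /=.
  by case: (_ < _)%N (e i j) => [] [].
lia.
Qed.

Lemma edits_le :
  (\sum_i \sum_j (e i j != digon_chain i j) <= missing_ahead e + arcs_back e + n)%N.
Proof.
(* The last term n accounts for the backward arcs of the chain: vertex i has at
   most one, to i.-1. *)
rewrite -[X in (_ + X)%N]card_ord -sum1_card -!big_split; apply: leq_sum => i _ /=.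
have : (\sum_(j < n) (i.-1 <= j < i) <= 1)%N.
  by rewrite sum_ord_between; have := ltn_ord i; lia.
move=> le1; apply: leq_trans (leq_add (leqnn _) le1).
rewrite -!big_split; apply: leq_sum => j _ /=.
have [-> | ] := eqVneq i j.
  by rewrite irr /digon_chain !ltnn !eqxx.
rewrite /digon_chain -val_eqE; case: (e i j) => /=; lia.
Qed.

(** * Stability of the degree sequence *)

Variable R : realType.
Let a (i : 'I_n) : R := n%:R - i%:R - 2^-1.
Let t (i : 'I_n) : R := (d i)%:R - a i.
Let Q : R := (\sum_i \sum_j ~~ e i j * (d i - d j))%N%:R.

(** Expand the squares t_i^2 = d_i^2 - 2 d_i a_i + a_i^2 and bound the cross term
    with [outdeg_energy]; n/12 is the gap between n^3/3 and the sum of a_i^2. *)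
Lemma outdeg_deviation :
  \sum_i t i ^+ 2 + 2 * Q + n%:R / 12 <= n%:R ^+ 3 / 3 - \sum_i (d i)%:R ^+ 2.
Proof.
have aE (i : 'I_n) : ((n - i).*2.-1)%:R = 2 * a i.
  have lin := ltn_ord i.
  have : (((n - i).*2.-1 + i.*2).+1 = n.*2)%N by lia.
  move/(congr1 (fun k => k%:R : R)); rewrite -addn1 !natrD -!addnn !natrD /a; lra.
have sumA : \sum_i (a i) ^+ 2 = n%:R ^+ 3 / 3 - n%:R / 12.
  have /(congr1 (fun k => k%:R : R)) := sum_odd_squares n.
  rewrite natrD !natrM natr_sum.
  under [X in X * _ + _ = _ -> _]eq_bigr do rewrite natrX aE exprMn.
  rewrite -mulr_sumr; lra.
have := outdeg_energy; rewrite -(ler_nat R) natrD -!muln2 !natrM -/Q !natr_sum.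
under [X in X * _ + _ <= _ -> _]eq_bigr do rewrite natrX.
under [X in _ <= X -> _]eq_bigr do rewrite natrM aE mulrCA.
rewrite -mulr_sumr => energy.
have -> : \sum_i t i ^+ 2
  = \sum_i (d i)%:R ^+ 2 + \sum_i (a i) ^+ 2 - 2 * \sum_i (d i)%:R * a i.
  rewrite mulr_sumr -sumrN -!big_split; apply: eq_bigr => i _ /=; rewrite /t; ring.
rewrite sumA; lra.
Qed.

(** A missing pair i < j has d_i - d_j >= s, or else j - i is smaller than one of
    3s, 3|t_i|, 3|t_j|.  The former pairs are paid for by Q; a fixed vertex is
    within distance x of at most x vertices on either side. *)
Lemma missing_ahead_le (s : R) : 0 < s ->
  s * (missing_ahead e)%:R
    <= Q + s * (3 * s * n%:R + 6 * \sum_i `|t i|).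
Proof.
move=> s0.
pose near (x : R) (i j : 'I_n) := (i < j)%N && (j%:R - i%:R < x).
(* If none of the three events holds, then j - i >= s + |t_i| + |t_j|, hence
   d_i - d_j = (j - i) + t_i - t_j >= s. *)
have pt (i j : 'I_n) : s * ((i < j) && ~~ e i j)%N%:R <= (~~ e i j * (d i - d j))%N%:R +
   s * ((near (3 * s) i j)%:R + (near (3 * `|t i|) i j)%:R + (near (3 * `|t j|) i j)%:R).
  have s_ge0 := ltW s0.
  have [/andP[ij nij]|_] := boolP (_ && _); last first.
    by rewrite mulr0 addr_ge0 ?mulr_ge0 ?addr_ge0.
  rewrite /near ij /= nij mul1n mulr1.
  have far : (d i)%:R - (d j)%:R <= (d i - d j)%N%:R :> R.
    by rewrite lerBlDr -natrD ler_nat; lia.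
  have Q0 : 0 <= (d i - d j)%N%:R :> R by [].
  have := ler_norm (t j); have := ler_norm (- t i); rewrite normrN.
  have := normr_ge0 (t i); have := normr_ge0 (t j).
  case: ltP => h1; case: ltP => h2; case: ltP => h3;
    rewrite ?(mulr1, mulr0, addr0, add0r) ?mulrDr ?mulr1; try lra.
  rewrite /t /a in h1 h2 h3 *; lra.
rewrite /missing_ahead natr_sum mulr_sumr.
pose N (x : 'I_n -> 'I_n -> R) := (\sum_(i < n) \sum_(j < n) near (x i j) i j)%N%:R : R.
apply: (@le_trans _ _ (Q + s * (N (fun _ _ => (3 * s)%R) + N (fun i _ => 3 * `|t i|)
  + N (fun _ j => 3 * `|t j|)))).
  rewrite /Q /N !natr_sum !mulrDr !mulr_sumr -!big_split; apply: ler_sum => i _ /=.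
  rewrite !natr_sum !mulr_sumr -!big_split; apply: ler_sum => j _ /=.
  by rewrite -!mulrDr; apply: pt.
rewrite lerD2l ler_pM2l //.
have N1 : N (fun _ _ => (3 * s)%R) <= 3 * s * n%:R.
  rewrite /N natr_sum -sum_const_ord.
  by apply: ler_sum => i _; apply: after_le; rewrite mulr_ge0 // ltW.
have N2 : N (fun i _ => 3 * `|t i|) <= 3 * \sum_i `|t i|.
  rewrite /N natr_sum mulr_sumr; apply: ler_sum => i _.
  by apply: after_le; rewrite mulr_ge0.
have N3 : N (fun _ j => 3 * `|t j|) <= 3 * \sum_i `|t i|.
  rewrite /N exchange_big natr_sum mulr_sumr; apply: ler_sum => j _.
  by apply: before_le; rewrite mulr_ge0.
lra.
Qed.

Lemma edits_le_scale (s : R) : (0 < n)%N -> 0 <= s ->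
    n%:R ^+ 3 / 3 - s ^+ 2 * n%:R <= \sum_i (d i)%:R ^+ 2 ->
  (\sum_i \sum_j (e i j != digon_chain i j))%N%:R <= 24 * s * n%:R.
Proof.
move=> n0 s_ge0 big_d; have n0R : 0 < n%:R :> R by rewrite ltr0n.
have dev := outdeg_deviation; have Q0 : 0 <= Q by [].
have t0 : 0 <= \sum_i t i ^+ 2 by apply: sumr_ge0 => i _; apply: sqr_ge0.
have s_ge : 1 <= 4 * s.
  have : n%:R / 12 <= s ^+ 2 * n%:R by lra.
  rewrite mulrC ler_pM2r // => s2; nra.
have s0 : 0 < s by lra.
have miss := missing_ahead_le s0.
have := edits_le; have := arcs_back_le; rewrite -!(ler_nat R) -!addnn !natrD => BM EMB.
have t_sum : 2 * s * \sum_i `|t i| <= \sum_i t i ^+ 2 + s ^+ 2 * n%:R.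
  rewrite mulr_sumr -sum_const_ord -big_split.
  apply: ler_sum => i _ /=; have := sqr_ge0 (`|t i| - s).
  by rewrite sqrrB real_normK ?num_real //; lra.
have Mle : (missing_ahead e)%:R <= 9 * s * n%:R.
  rewrite -(ler_pM2l s0); lra.
(* 24 s n = 2 (9 s n) + (3/2) (4 s n), by edits <= 2 M + (3/2) n. *)
nra.
Qed.

End DecreasingLabelling.

(** * Transfer to the sorted labelling *)

Lemma edit_dist_le (V W : finType) (e : rel V) (f : rel W) (h : V -> W) : bijective h ->
  (edit_dist e f <= \sum_x \sum_y (e x y != f (h x) (h y)))%N.
Proof.
move=> bij_h; pose S := [set p : V * V | e p.1 p.2 != f (h p.1) (h p.2)].
have -> : (\sum_x \sum_y (e x y != f (h x) (h y)) = #|S|)%N.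
  rewrite pair_big -sum1_card [RHS]big_mkcond; apply: eq_bigr => p _.
  by rewrite inE; case: (_ != _).
rewrite /edit_dist -leEnat; apply: bigmin_le_cond; apply/asboolP; exists h => // x y.
by rewrite /edit inE; case: (e x y) (f _ _) => [] [].
Qed.

Lemma sorted_enum (V : finType) (d : V -> nat) :
  exists2 g : 'I_#|V| -> V, bijective g &
    forall i j : 'I_#|V|, (i <= j)%N -> (d (g j) <= d (g i))%N.
Proof.
pose r : rel V := fun x y => (d y <= d x)%N.
have r_tr : transitive r by move=> y x z xy yz; apply: leq_trans yz xy.
have r_tot : total r by move=> x y; apply: leq_total.
have size_s : size (sort r (enum V)) == #|V| by rewrite size_sort -cardE.
pose s := Tuple size_s.
have inj : injective (tnth s) by apply/tuple_uniqP; rewrite sort_uniq enum_uniq.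
exists (tnth s); first by apply: inj_card_bij => //; rewrite card_ord.
move=> i j ij; have x0 := tnth s i; rewrite !(tnth_nth x0).
by apply: (sorted_leq_nth r_tr) => //; rewrite ?inE ?(eqP size_s) ?ltn_ord //;
  [move=> x; apply: leqnn | apply: sort_sorted].
Qed.

Theorem theorem3p4 (R : realType) :
  exists2 C : R, 0 < C &
    forall (n : nat) (delta : R), (1 <= n)%N -> 0 <= delta ->
    forall (V : finType) (e : rel V),
      #|V| = n -> irreflexive e -> C3_free e ->
      n%:R ^+ 3 / 3%:R - delta * n%:R ^+ 3
        <= \sum_(v : V) (outdeg e v)%:R ^+ 2 :> R ->
      (edit_dist e (@digon_chain n))%:R <= C * Num.sqrt delta * n%:R ^+ 2 :> R.
Proof.
exists 24 => // n delta n0 delta0 V e Vn irr C3 degs; subst n.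
have [g bij_g d_anti] := sorted_enum (outdeg e).
have [h gK hK] := bij_g.
have bij_h : bijective h by exists g.
pose e' : rel 'I_#|V| := fun i j => e (g i) (g j).
have out i : outdeg e' i = outdeg e (g i).
  by rewrite !outdegE [RHS](reindex g) //; apply: onW_bij.
have irr' : irreflexive e' by move=> i; apply: irr.
have tri' i j k : e' i j -> e' j k -> ~~ e' k i by apply: (C3_freeW irr C3).
have anti' (i j : 'I_#|V|) : (i <= j)%N -> (outdeg e' j <= outdeg e' i)%N.
  by rewrite !out; apply: d_anti.
have := edit_dist_le e (@digon_chain #|V|) bij_h; rewrite -(ler_nat R).
have edits_g : (\sum_x \sum_y (e x y != digon_chain (h x) (h y)) =
    \sum_i \sum_j (e' i j != digon_chain i j))%N.
  rewrite (reindex g) /=; last exact: onW_bij.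
  apply: eq_bigr => i _; rewrite (reindex g) /=; last exact: onW_bij.
  by apply: eq_bigr => j _; rewrite !gK.
rewrite edits_g => /le_trans; apply.
have degs' : \sum_i (outdeg e' i)%:R ^+ 2 = \sum_v (outdeg e v)%:R ^+ 2 :> R.
  rewrite [RHS](reindex g) /=; last exact: onW_bij.
  by apply: eq_bigr => i _; rewrite out.
have s0 : 0 <= Num.sqrt delta * #|V|%:R by rewrite mulr_ge0 ?sqrtr_ge0.
have := edits_le_scale irr' tri' anti' n0 s0.
rewrite degs' exprMn sqr_sqrtr // => E.
have -> : 24 * Num.sqrt delta * #|V|%:R ^+ 2
  = 24 * (Num.sqrt delta * #|V|%:R) * #|V|%:R by ring.
by apply: E; lra.
Qed.
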